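(* For every fixed partition $\lambda$, as $q$ ranges over prime powers, $P(s_\lambda\mapsto 0)=1/q+O(1/q^2)$ as $q\to\infty$, where the probability is taken over a uniformly random ring homomorphism $\Lambda\to\mathbb{F}_q$.
   Context: $\Lambda$ is the ring of symmetric functions over $\mathbb{Z}$, $h_k$ the complete homogeneous symmetric functions, $s_\lambda$ the Schur functions. A uniformly random ring homomorphism $\Lambda\to\mathbb{F}_q$ is obtained by sending $h_1,h_2,\dots$ to independent uniformly random elements of $\mathbb{F}_q$. $f(q)=O(g(q))$ means there are constants $c,n_0>0$ with $|f(q)|\leq c|g(q)|$ for $q>n_0$.
   Formalization: The partition λ is assumed nonempty: for the empty partition the Schur function is 1, which is never sent to 0, so the probability is 0 and the claimed estimate 1/q + O(1/q²) fails. *)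

(* Defs.v *)
From HB Require Import structures.
From mathcomp Require Import all_boot all_order all_fingroup all_algebra zify.
From mathcomp Require Import mpoly.
From mathcomp Require Import all_classical all_reals all_analysis.

Set Implicit Arguments.
Unset Strict Implicit.
Unset Printing Implicit Defensive.

Import Order.TTheory GRing.Theory Num.Theory.
Local Open Scope ring_scope.

(* The projection sending the last variable to 0 and fixing the others. *)
Definition restrict_last n (p : {mpoly int[n.+1]}) : {mpoly int[n]} :=
  p \mPo [tuple oapp (fun j : 'I_n => 'X_j) 0 (unlift ord_max i) | i < n.+1].

(* The ring of symmetric functions over the integers is the inverse limit, in
   the category of graded rings, of the rings of symmetric polynomials in n
   variables: an element is a compatible family of bounded degree. *)
Definition is_symfun (f : forall n, {mpoly int[n]}) : Prop :=
  [/\ forall n, f n \is symmetric,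
      forall n, restrict_last (f n.+1) = f n
    & exists d, forall n, (msize (f n) <= d)%N].

Record symfun := SymFun {
  symfun_val :> forall n, {mpoly int[n]};
  symfunP : is_symfun symfun_val }.

HB.instance Definition _ := gen_eqMixin symfun.
HB.instance Definition _ := gen_choiceMixin symfun.

Lemma symfun_ext (f g : symfun) : (forall n, f n = g n) -> f = g.
Proof.
case: f g => [f fP] [g gP] /= fg.
have fgE : f = g by apply: functional_extensionality_dep.
by case: _ / fgE gP => gP; congr SymFun; exact: Prop_irrelevance.
Qed.

Lemma is_symfun0 : is_symfun (fun n => 0).
Proof.
split=> [n|n|]; first exact: rpred0.
  by rewrite /restrict_last raddf0.
by exists 0%N => n; rewrite msize0.
Qed.

Lemma is_symfun1 : is_symfun (fun n => 1).
Proof.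
split=> [n|n|]; first exact: rpred1.
  by rewrite /restrict_last rmorph1.
by exists 1%N => n; rewrite msize1.
Qed.

Lemma is_symfunN (f : symfun) : is_symfun (fun n => - f n).
Proof.
have [fs fc [d fd]] := symfunP f.
split=> [n|n|]; first by rewrite /= rpredN fs.
  by rewrite /restrict_last raddfN /= -/(restrict_last _) fc.
by exists d => n; rewrite msizeN.
Qed.

Lemma is_symfunD (f g : symfun) : is_symfun (fun n => f n + g n).
Proof.
have [fs fc [d fd]] := symfunP f; have [gs gc [e ge]] := symfunP g.
split=> [n|n|]; first by rewrite /= rpredD ?fs ?gs.
  by rewrite /restrict_last raddfD /= -!/(restrict_last _) fc gc.
exists (maxn d e) => n; apply: leq_trans (msizeD_le _ _) _.
by rewrite geq_max !leq_max fd ge orbT.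
Qed.

Lemma is_symfunM (f g : symfun) : is_symfun (fun n => f n * g n).
Proof.
have [fs fc [d fd]] := symfunP f; have [gs gc [e ge]] := symfunP g.
split=> [n|n|]; first by rewrite /= rpredM ?fs ?gs.
  by rewrite /restrict_last rmorphM /= -!/(restrict_last _) fc gc.
exists (d + e)%N => n; have [->|f0] := eqVneq (f n) 0.
  by rewrite mul0r msize0.
have [->|g0] := eqVneq (g n) 0; first by rewrite mulr0 msize0.
by rewrite msizeM // (leq_trans (leq_pred _)) // leq_add.
Qed.

Definition symfun0 := SymFun is_symfun0.
Definition symfun1 := SymFun is_symfun1.
Definition symfunN f := SymFun (is_symfunN f).
Definition symfunD f g := SymFun (is_symfunD f g).
Definition symfunM f g := SymFun (is_symfunM f g).

Fact symfunDA : associative symfunD.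
Proof. by move=> f g h; apply: symfun_ext => n; exact: addrA. Qed.
Fact symfunDC : commutative symfunD.
Proof. by move=> f g; apply: symfun_ext => n; exact: addrC. Qed.
Fact symfunD0 : left_id symfun0 symfunD.
Proof. by move=> f; apply: symfun_ext => n; exact: add0r. Qed.
Fact symfunDN : left_inverse symfun0 symfunN symfunD.
Proof. by move=> f; apply: symfun_ext => n; exact: addNr. Qed.
Fact symfunMA : associative symfunM.
Proof. by move=> f g h; apply: symfun_ext => n; exact: mulrA. Qed.
Fact symfunMC : commutative symfunM.
Proof. by move=> f g; apply: symfun_ext => n; exact: mulrC. Qed.
Fact symfunM1 : left_id symfun1 symfunM.
Proof. by move=> f; apply: symfun_ext => n; exact: mul1r. Qed.
Fact symfunMD : left_distributive symfunM symfunD.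
Proof. by move=> f g h; apply: symfun_ext => n; exact: mulrDl. Qed.
Fact symfun_neq0 : symfun1 != symfun0.
Proof.
apply/eqP => /(congr1 (fun f : symfun => f 0%N)) /eqP.
by rewrite /= oner_eq0.
Qed.

HB.instance Definition _ := GRing.isZmodule.Build symfun
  symfunDA symfunDC symfunD0 symfunDN.
HB.instance Definition _ := GRing.Zmodule_isComNzRing.Build symfun
  symfunMA symfunMC symfunM1 symfunMD symfun_neq0.

(* Sum of all the monomials of degree k in n variables. *)
Definition hsym n k : {mpoly int[n]} :=
  \sum_(m : 'X_{1..n < k.+1} | mdeg m == k) 'X_[m].

Definition is_partition (l : seq nat) : bool := sorted geq l && (0%N \notin l).

Record intpart := IntPart {
  parts :> seq nat;
  intpartP : is_partition parts }.

(* Cells (row, column) of the Young diagram of l, both counted from 0. *)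
Definition cell (l : seq nat) : finType :=
  {c : 'I_(size l) * 'I_(head 0%N l) | (c.2 < nth 0 l c.1)%N}.

(* Rows weakly increase, columns strictly increase. *)
Definition semistandard n l (T : {ffun cell l -> 'I_n}) : bool :=
  [forall c : cell l, forall d : cell l,
    [&& (val c).1 == (val d).1 & ((val c).2 <= (val d).2)%N] ==> (T c <= T d)%N]
  && [forall c : cell l, forall d : cell l,
    [&& (val c).2 == (val d).2 & ((val c).1 < (val d).1)%N] ==> (T c < T d)%N].

Definition schur_poly n (l : seq nat) : {mpoly int[n]} :=
  \sum_(T : {ffun cell l -> 'I_n} | semistandard T) \prod_(c : cell l) 'X_(T c).


(* The families (hsym n k)_n and (schur_poly n l)_n are symmetric functions. For
   Schur polynomials this goes through the Jacobi-Trudi identity: a sum over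
   tableaux and a determinant satisfy the same branching rule when a variable
   is added. In the sums rect_sum, a filling is extended by the value N to an
   r x c rectangle containing the diagram; x is a sequence of values for the
   variables, of which the first n are used. *)
Section CompleteSymmetric.
Variables (R : comNzRingType) (x : nat -> R).

Fixpoint hh n k : R :=
  if n is n'.+1 then \sum_(a < k.+1) x n' ^+ a * hh n' (k - a)%N else (k == 0%N)%:R.

Variable r : nat.
Definition shifted_hh n m : R := if (m < r)%N then 0 else hh n (m - r)%N.

Lemma shifted_hhS n m :
  shifted_hh n.+1 m = \sum_(a < m.+1) x n ^+ a * shifted_hh n (m - a)%N.
Proof.
rewrite {1}/shifted_hh; case: ltnP => [m_lt_r|r_le_m].
  by rewrite big1 // => a _; rewrite /shifted_hh ifT ?mulr0 //; lia.
have -> : m.+1 = ((m - r).+1 + r)%N by lia.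
rewrite big_split_ord /= [X in _ = _ + X]big1 ?addr0 => [|a _].
  by apply: eq_bigr => a _; rewrite /shifted_hh ifF; [congr (_ * hh _ _)|]; have := ltn_ord a; lia.
by rewrite /shifted_hh ifT ?mulr0 //; have := ltn_ord a; lia.
Qed.

Lemma shifted_hh_step n d m :
  shifted_hh n.+1 (d + m)%N =
  \sum_(a < d) x n ^+ a * shifted_hh n (d + m - a)%N + x n ^+ d * shifted_hh n.+1 m.
Proof.
rewrite !shifted_hhS -addnS big_split_ord /= mulr_sumr; congr (_ + _).
by apply: eq_bigr => a _; rewrite exprD mulrA subnDl.
Qed.

Definition jt_det n (L : nat -> nat) : R :=
  \det (\matrix_(i < r, j < r) shifted_hh n (L i + (r - i) + j)%N).

Variable c : nat.
Definition shape_ok (L : nat -> nat) : Prop :=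
  [/\ forall i j, (i <= j)%N -> (L j <= L i)%N, L r = 0%N & (L 0 <= c)%N].
Definition mu_shape (mu : {ffun 'I_r -> 'I_c.+1}) i : nat :=
  oapp (fun k => nat_of_ord (mu k)) 0%N (insub i).
Definition interlaced (L : nat -> nat) (mu : {ffun 'I_r -> 'I_c.+1}) : bool :=
  [forall i : 'I_r, (L i.+1 <= mu i <= L i)%N].

Lemma mu_shapeE mu (i : 'I_r) : mu_shape mu i = mu i.
Proof. by rewrite /mu_shape valK. Qed.

Lemma mu_shape_ok L mu : shape_ok L -> interlaced L mu -> shape_ok (mu_shape mu).
Proof.
move=> [Lanti Lr Lc] /forallP muP.
have mono i j : (i <= j)%N -> (mu_shape mu j <= mu_shape mu i)%N.
  move=> ij; have [jr|jr] := ltnP j r; last by rewrite {1}/mu_shape insubF //; lia.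
  have ir : (i < r)%N by lia.
  rewrite (mu_shapeE mu (Ordinal jr)) (mu_shapeE mu (Ordinal ir)).
  have [e|nij] := eqVneq i j; first by subst j; rewrite (bool_irrelevance ir jr).
  have /andP[h1 _] := muP (Ordinal ir); have /andP[_ h2] := muP (Ordinal jr).
  have := Lanti i.+1 j; move: h1 h2 => /=; lia.
split=> //; first by rewrite /mu_shape insubF //; lia.
by rewrite /mu_shape; case: insub => //= i; rewrite -ltnS.
Qed.

Lemma jt_det_rec n L : shape_ok L ->
  jt_det n.+1 L = \sum_(mu | interlaced L mu)
    x n ^+ (\sum_(i < r) (L i - mu i))%N * jt_det n (mu_shape mu).
Proof.
move=> [Lanti Lr Lc]; rewrite /jt_det.
pose p i := (L i + (r - i))%N.
set A := (\matrix_(i, j) _).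
pose U : 'M[R]_r := \matrix_(i, j)
  ((i == j)%:R - (nat_of_ord j == i.+1)%:R * x n ^+ (p i - p i.+1)%N).
have detU : \det U = 1.
  rewrite -det_tr det_trig.
    rewrite big1 // => i _; rewrite !mxE eqxx.
    have -> : (i == i.+1 :> nat) = false by lia.
    rewrite mul0r subr0.
    by [].
  apply/is_trig_mxP => i j ij; rewrite !mxE.
  have -> : (j == i) = false by rewrite -val_eqE /=; lia.
  have -> : (i == j.+1 :> nat) = false by lia.
  by rewrite mul0r subr0.
have pS i : (i < r)%N -> (p i.+1 < p i)%N.
  by rewrite /p => ir; have := Lanti i i.+1 (leqnSn _); lia.
have UA (i j : 'I_r) : (U *m A) i j =
    \sum_(v < c.+1 | (L i.+1 <= v <= L i)%N)
      x n ^+ (L i - v)%N * shifted_hh n (v + (r - i) + j)%N.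
  have -> : (U *m A) i j = shifted_hh n.+1 (p i + j)%N
             - x n ^+ (p i - p i.+1)%N * shifted_hh n.+1 (p i.+1 + j)%N.
    rewrite mxE (bigD1 i) //= !mxE eqxx.
    have -> : (i == i.+1 :> nat) = false by lia.
    rewrite mul0r subr0 mul1r; congr (_ + _).
    have [ir|ir] := ltnP i.+1 r.
      rewrite (bigD1 (Ordinal ir)) /=; last by rewrite -val_eqE /=; lia.
      rewrite big1 ?addr0 => [|k /andP[ki kS]]; rewrite !mxE.
        have -> : (i == Ordinal ir) = false by rewrite -val_eqE /=; lia.
        by rewrite eqxx sub0r mul1r mulNr.
      rewrite eq_sym (negPf ki); have -> : (k == i.+1 :> nat) = false.
        by move: kS; rewrite -val_eqE /=; lia.
      by rewrite mul0r subr0 mul0r.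
    rewrite big1 => [|k ki].
      have -> : p i.+1 = 0%N.
        have e : i.+1 = r by have := ltn_ord i; lia.
        by rewrite /p e Lr subnn.
      by rewrite add0n /shifted_hh ltn_ord mulr0 oppr0.
    rewrite !mxE eq_sym (negPf ki); have -> : (k == i.+1 :> nat) = false.
      by have := ltn_ord k; lia.
    by rewrite mul0r subr0 mul0r.
  have pSi := pS i (ltn_ord i).
  have -> : (p i + j = (p i - p i.+1) + (p i.+1 + j))%N by lia.
  rewrite shifted_hh_step addrK.
  rewrite (reindex_omap (fun a : 'I_(p i - p i.+1) => inord (L i - a))
             (fun v : 'I_c.+1 => insub (L i - v)%N)) /=; last first.
    move=> v /andP[v1 v2]; rewrite insubT /=.
      by rewrite /p; have := ltn_ord i; lia.
    by move=> H; congr Some; apply/val_inj; rewrite /= inordK; have := ltn_ord v; lia.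
  have Lic : (L i <= c)%N by apply: leq_trans Lc; exact: Lanti.
  have pE : (p i - p i.+1 = (L i - L i.+1).+1)%N.
    by rewrite /p; have := Lanti i i.+1 (leqnSn _); have := ltn_ord i; lia.
  have LiS := Lanti i i.+1 (leqnSn _).
  apply: eq_big => [a|a _].
    symmetry; have aP : (a < (L i - L i.+1).+1)%N by rewrite -pE.
    rewrite inordK; last by lia.
    have -> : (L i - (L i - a) = a)%N by lia.
    by rewrite valK eqxx andbT; lia.
  have aP : (a < (L i - L i.+1).+1)%N by rewrite -pE.
  rewrite inordK; last by lia.
  have -> : (L i - (L i - a) = a)%N by lia.
  congr (_ * shifted_hh _ _).
  by move: pE aP; rewrite /p; have := ltn_ord i; lia.
rewrite -[LHS]mul1r -detU -det_mulmx /determinant.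
under [LHS]eq_bigr => s _.
  under eq_bigr => i _ do rewrite UA.
  rewrite (bigA_distr_big_dep (fun i : 'I_r => [pred v : 'I_c.+1 | (L i.+1 <= v <= L i)%N])
    (fun (i : 'I_r) (v : 'I_c.+1) => x n ^+ (L i - v)%N * shifted_hh n (v + (r - i) + s i)%N)) /=.
  rewrite mulr_sumr.
  over.
rewrite exchange_big /=; apply: eq_big => [mu|mu _].
  apply/familyP/forallP => h i; exact: h.
rewrite mulr_sumr; apply: eq_bigr => s _.
rewrite big_split /= mulrCA prodrXr; congr (_ * (_ * _)).
by apply: eq_bigr => i _; rewrite mxE mu_shapeE.
Qed.

Lemma jt_det0 L : shape_ok L -> jt_det 0 L = (L 0 == 0)%N%:R.
Proof.
move=> [Lanti Lr Lc]; rewrite /jt_det; have [L0|L0] := eqVneq (L 0%N) 0%N.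
  rewrite -[RHS](det1 R r); congr (\det _); apply/matrixP => i j; rewrite !mxE.
  have -> : L i = 0%N by apply/eqP; rewrite -leqn0 -L0 Lanti.
  rewrite /shifted_hh add0n -val_eqE /=; have ir := ltn_ord i.
  case: ltnP => h; last by congr ((nat_of_bool _)%:R); lia.
  by have -> : (i == j :> nat) = false by lia.
case: (posnP r) => [r0|r0]; first by move: L0; have := Lr; rewrite r0 => ->.
rewrite (expand_det_row _ (Ordinal r0)) big1 // => j _; rewrite !mxE /=.
rewrite /shifted_hh; case: ltnP => h; first by rewrite mul0r.
rewrite /=; have -> : (L 0 + (r - 0) + j - r == 0)%N = false by lia.
by rewrite mul0r.
Qed.

Variable N : nat.
Implicit Types (L : nat -> nat) (G : {ffun 'I_r * 'I_c -> 'I_N.+1}).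

Definition rect_ss n L G : bool :=
  [forall u : 'I_r * 'I_c, if (u.2 < L u.1)%N then (G u < n)%N else G u == N :> nat]
  && [forall u : 'I_r * 'I_c, forall v : 'I_r * 'I_c,
       (u.2 < L u.1)%N ==> (v.2 < L v.1)%N ==>
       ((u.1 == v.1) && (u.2 <= v.2)%N ==> (G u <= G v)%N)
       && ((u.2 == v.2) && (u.1 < v.1)%N ==> (G u < G v)%N)].

Definition rect_sum n L : R :=
  \sum_(G | rect_ss n L G) \prod_(u : 'I_r * 'I_c | (u.2 < L u.1)%N) x (G u).

Lemma rect_ssP n L G :
  reflect [/\ forall u : 'I_r * 'I_c, (u.2 < L u.1)%N -> (G u < n)%N,
              forall u : 'I_r * 'I_c, (L u.1 <= u.2)%N -> G u = N :> nat,
              forall (i : 'I_r) (j k : 'I_c), (k < L i)%N -> (j <= k)%N -> (G (i, j) <= G (i, k))%N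
            & forall (i k : 'I_r) (j : 'I_c), (j < L i)%N -> (j < L k)%N -> (i < k)%N ->
                (G (i, j) < G (k, j))%N]
          (rect_ss n L G).
Proof.
apply: (iffP andP) => [[/forallP h1 /forallP h2]|[h1 h2 h3 h4]]; split.
- by move=> u uL; have := h1 u; rewrite uL.
- by move=> u uL; have := h1 u; rewrite ltnNge uL => /eqP.
- move=> i j k kL jk; have /forallP/(_ (i, k)) := h2 (i, j).
  by rewrite /= kL (leq_ltn_trans jk kL) eqxx jk => /andP[].
- move=> i k j jLi jLk ik; have /forallP/(_ (k, j)) := h2 (i, j).
  by rewrite /= jLi jLk eqxx ik => /andP[].
- by apply/forallP => u; case: ltnP => uL; [exact: h1 | apply/eqP; exact: h2].
- apply/forallP => -[i j]; apply/forallP => -[k l] /=.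
  apply/implyP => uL; apply/implyP => vL; apply/andP; split; apply/implyP.
    by case/andP=> /eqP ik jl; subst k; exact: h3.
  by case/andP=> /eqP ik jl; subst l; exact: h4.
Qed.

Lemma down_closed (b : pred 'I_c) :
  (forall j k : 'I_c, (j <= k)%N -> b k -> b j) ->
  exists v : 'I_c.+1, forall j, b j = (j < v)%N.
Proof.
move=> bP; pose B k := oapp b false (insub k).
have BE (j : 'I_c) : B j = b j by rewrite /B valK.
have exB : exists k, ~~ B k by exists c; rewrite /B insubF ?ltnn.
case: (ex_minnP exB) => v Bv vmin.
have vc : (v < c.+1)%N by rewrite ltnS; apply: vmin; rewrite /B insubF ?ltnn.
exists (Ordinal vc) => j /=; apply/idP/idP => [bj|jv]; last first.
  by apply: contraTT jv => bj; rewrite -leqNgt; apply: vmin; rewrite BE.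
rewrite ltnNge; apply: contra Bv => vj.
have vc' : (v < c)%N by exact: leq_ltn_trans vj (ltn_ord j).
by rewrite -[v]/(nat_of_ord (Ordinal vc')) BE; apply: bP bj.
Qed.

Definition compat n G (mu : {ffun 'I_r -> 'I_c.+1}) : bool :=
  [forall u : 'I_r * 'I_c, (G u < n)%N == (u.2 < mu u.1)%N].

Lemma compat_inj n G mu nu : compat n G mu -> compat n G nu -> mu = nu.
Proof.
move=> /forallP h /forallP h'; apply/ffunP => i; apply/val_inj => /=.
have H (j : 'I_c) : (j < mu i)%N = (j < nu i)%N.
  by have /eqP/= <- := h (i, j); have /eqP/= <- := h' (i, j).
have cm := ltn_ord (mu i); have cn := ltn_ord (nu i).
case: (ltngtP (mu i) (nu i)) => // lt.
  have lc : (mu i < c)%N by lia.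
  by have := H (Ordinal lc); rewrite /= lt ltnn.
have lc : (nu i < c)%N by lia.
by have := H (Ordinal lc); rewrite /= lt ltnn.
Qed.

Lemma compat_ex n L G : (n < N)%N -> rect_ss n.+1 L G -> exists mu, compat n G mu.
Proof.
move=> nN /rect_ssP[h1 h2 h3 h4].
have rowP i : exists v : 'I_c.+1, [forall j, (G (i, j) < n)%N == (j < v)%N].
  suff [v vP] : exists v : 'I_c.+1, forall j, (G (i, j) < n)%N = (j < v)%N.
    by exists v; apply/forallP => j; rewrite vP.
  apply: down_closed => j k jk /= Gk.
  have [kL|kL] := ltnP k (L i); last by move: Gk; rewrite (h2 (i, k)) //; lia.
  by apply: leq_ltn_trans Gk; exact: h3.
exists [ffun i => xchoose (rowP i)]; apply/forallP => -[i j] /=.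
by rewrite ffunE; have /forallP := xchooseP (rowP i); exact.
Qed.

Lemma compat_interlaced n L G mu : shape_ok L -> (n < N)%N ->
  rect_ss n.+1 L G -> compat n G mu -> interlaced L mu.
Proof.
move=> [Lanti Lr Lc] nN /rect_ssP[h1 h2 h3 h4] /forallP cmp; apply/forallP => i.
have cE j : (G (i, j) < n)%N = (j < mu i)%N by have /eqP := cmp (i, j).
have mc := ltn_ord (mu i).
apply/andP; split; rewrite leqNgt; apply/negP => lt.
  have ir : (i.+1 < r)%N.
    rewrite ltnNge; apply/negP => ir; have := Lanti _ _ ir; lia.
  have Lic : (L i.+1 <= c)%N by apply: leq_trans Lc; exact: Lanti.
  have jc : (mu i < c)%N by lia.
  have := h4 i (Ordinal ir) (Ordinal jc).
  have := h1 (Ordinal ir, Ordinal jc); have := cE (Ordinal jc).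
  have := Lanti i i.+1 (leqnSn _); move=> /=; lia.
have jc : (L i < c)%N by lia.
have := h2 (i, Ordinal jc); have := cE (Ordinal jc); move=> /=; lia.
Qed.

Lemma rect_sum_rec n L : shape_ok L -> (n < N)%N ->
  rect_sum n.+1 L = \sum_(mu | interlaced L mu)
    x n ^+ (\sum_(i < r) (L i - mu i))%N * rect_sum n (mu_shape mu).
Proof.
move=> Lok nN.
pose mu0 : {ffun 'I_r -> 'I_c.+1} := [ffun=> ord0].
pose muG G := odflt mu0 [pick mu | compat n G mu].
have muGP G mu : rect_ss n.+1 L G -> (muG G == mu) = compat n G mu.
  move=> Gss; rewrite /muG; case: pickP => [nu /= cnu|/= no]; last first.
    by have [nu] := compat_ex nN Gss; rewrite no.
  apply/eqP/idP => [<- //|]; exact: compat_inj.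
rewrite /rect_sum (partition_big muG (interlaced L)) /=; last first.
  move=> G Gss; apply: (compat_interlaced Lok nN Gss).
  by rewrite -muGP // eqxx.
apply: eq_bigr => mu muL; rewrite mulr_sumr.
have [Lanti Lr Lc] := Lok.
have muI (i : 'I_r) : (L i.+1 <= mu i <= L i)%N by exact: (forallP muL).
pose h G : {ffun _ -> _} := [ffun u : 'I_r * 'I_c => if (u.2 < mu u.1)%N then G u
   else inord (if (u.2 < L u.1)%N then n else N) : 'I_N.+1].
pose h' G : {ffun _ -> _} := [ffun u : 'I_r * 'I_c => if (u.2 < mu u.1)%N then G u
   else ord_max : 'I_N.+1].
have nN1 : (n < N.+1)%N by lia.
have hE G u : h G u = (if (u.2 < mu u.1)%N then nat_of_ord (G u) else
     if (u.2 < L u.1)%N then n else N) :> nat.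
  by rewrite ffunE; case: ifP => // _; rewrite inordK //; case: ifP => _; lia.
rewrite (reindex_onto h h') /=; last first.
  move=> G /andP[Gss]; rewrite muGP // => /forallP cmp.
  have /rect_ssP[h1 h2 h3 h4] := Gss.
  apply/ffunP => u; apply/val_inj; rewrite /= hE; case: ifP => mu_u; first by rewrite ffunE mu_u.
  have /eqP := cmp u; rewrite mu_u; case: (ltnP u.2 (L u.1)) => uL; [have := h1 u uL|have := h2 u uL]; lia.
apply: eq_big => [G|G /andP[/andP[Gss cmp] _]].
  apply/idP/idP.
    move=> /andP[/andP[Gss]]; rewrite muGP // => /forallP cmp /eqP hG.
    have /rect_ssP[h1 h2 h3 h4] := Gss.
    have hGE (u : 'I_r * 'I_c) : (u.2 < mu u.1)%N -> h G u = G u :> nat by move=> e; rewrite hE e.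
    apply/rect_ssP; split.
    - move=> u; rewrite mu_shapeE => e; have /eqP := cmp u; rewrite e hGE //.
    - move=> u; rewrite mu_shapeE leqNgt => /negPf e.
      by rewrite -hG ffunE e.
    - move=> i j k; rewrite mu_shapeE => k1 jk.
      have := h3 i j k; rewrite !hGE /=; [|lia..].
      by have := muI i; lia.
    - move=> i k j; rewrite !mu_shapeE => j1 j2 ik.
      have := h4 i k j; rewrite !hGE //=.
      by have := muI i; have := muI k; lia.
  move=> /rect_ssP[h1 h2 h3 h4].
  have G1 (u : 'I_r * 'I_c) : (u.2 < mu u.1)%N -> (G u < n)%N by move=> e; apply: h1; rewrite mu_shapeE.
  have Gss : rect_ss n.+1 L (h G).
    apply/rect_ssP; split.
    - by move=> u uL; rewrite hE uL; case: ifP => // /G1; lia.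
    - move=> u uL; rewrite hE; have /andP[_ mL] := muI u.1.
      case: ifP => [um|_]; first by have := leq_trans um mL; rewrite ltnNge uL.
      by rewrite ltnNge uL.
    - move=> i j k kL jk; rewrite !hE /= kL (leq_ltn_trans jk kL).
      have := h3 i j k; have := G1 (i, j); rewrite mu_shapeE /=.
      by have := muI i; case: ifP => ?; case: ifP => ?; lia.
    - move=> i k j jLi jLk ik; rewrite !hE /= jLi jLk.
      have := h4 i k j; have := G1 (i, j); rewrite !mu_shapeE /=.
      have := muI i; have := muI k; have := Lanti i.+1 k ik.
      by case: ifP => ?; case: ifP => ?; lia.
  rewrite Gss muGP //=; apply/andP; split.
    apply/forallP => u; rewrite hE; case: ifP => e; first by rewrite G1.
    by case: ifP => _; lia.
  apply/eqP/ffunP => u; rewrite ffunE; case: ifP => e; first by rewrite ffunE e.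
  by apply/val_inj => /=; rewrite h2 // mu_shapeE leqNgt e.
rewrite (bigID (fun u : 'I_r * 'I_c => (u.2 < mu u.1)%N)) /= mulrC.
congr (_ * _).
  rewrite (eq_bigr (fun=> x n)); last first.
    by move=> u /andP[u1 u2]; rewrite hE u1 (negPf u2).
  rewrite -prodrXr -(pair_big_dep predT
     (fun (i : 'I_r) (j : 'I_c) => (j < L i)%N && ~~ (j < mu i)%N) (fun _ _ => x n)) /=.
  apply: eq_bigr => i _; rewrite prodr_const; congr (_ ^+ _).
  have Lic : (L i <= c)%N by apply: leq_trans Lc; exact: Lanti.
  have card_lt v : (v <= c)%N -> (\sum_(j < c | (j < v)%N) 1 = v)%N.
    by move=> vc; rewrite (big_ord_narrow vc) sum1_card card_ord.
  have /andP[_ mL] := muI i.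
  have := card_lt _ Lic; rewrite (bigID (fun j : 'I_c => (j < mu i)%N)) /=.
  rewrite (eq_bigl (fun j : 'I_c => (j < mu i)%N)) => [|j]; last by lia.
  rewrite card_lt; last by lia.
  by rewrite sum1_card => e; rewrite -[L i in RHS]e addKn.
apply: eq_big => [u|u u_mu]; last by rewrite hE ifT //; case/andP: u_mu.
rewrite mu_shapeE; have := muI u.1; lia.
Qed.

Lemma rect_sum0 L : shape_ok L -> rect_sum 0 L = (L 0 == 0)%N%:R.
Proof.
move=> [Lanti Lr Lc]; have [L0|L0] := eqVneq (L 0%N) 0%N.
  have Lz i : L i = 0%N by apply/eqP; rewrite -leqn0 -L0 Lanti.
  rewrite /rect_sum (big_pred1 [ffun=> ord_max]) => [|G].
    by rewrite big_pred0 // => u; rewrite Lz.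
  apply/rect_ssP/eqP => [[_ h2 _ _]|->].
    by apply/ffunP => u; apply/val_inj; rewrite /= h2 ?Lz // ffunE.
  split=> [u|u|i j k|i k j]; rewrite ?Lz // => _; by rewrite ffunE.
rewrite /rect_sum big_pred0 // => G; apply/negbTE/negP => /rect_ssP[h1 _ _ _].
have r0 : (0 < r)%N by rewrite lt0n; apply: contraNneq L0 => r0; have := Lr; rewrite r0 => ->.
have c0 : (0 < c)%N by lia.
by have := h1 (Ordinal r0, Ordinal c0); rewrite /= lt0n L0 => /(_ isT).
Qed.

Lemma rect_sum_jt_det n L : shape_ok L -> (n <= N)%N -> rect_sum n L = jt_det n L.
Proof.
elim: n L => [|n IHn] L Lok nN; first by rewrite rect_sum0 ?jt_det0.
rewrite rect_sum_rec // jt_det_rec //; apply: eq_bigr => mu muL.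
by rewrite IHn ?(ltnW nN) //; exact: mu_shape_ok muL.
Qed.

End CompleteSymmetric.

Section Functoriality.
Variables (R S : comNzRingType) (f : {rmorphism R -> S}).

Lemma rmorph_hh x n k : f (hh x n k) = hh (f \o x) n k.
Proof.
elim: n k => [|n IHn] k /=; first by rewrite rmorph_nat.
by rewrite rmorph_sum; apply: eq_bigr => a _; rewrite rmorphM rmorphXn IHn.
Qed.

Lemma rmorph_jt_det x r n L : f (jt_det x r n L) = jt_det (f \o x) r n L.
Proof.
rewrite /jt_det -det_map_mx; congr (\det _); apply/matrixP => i j; rewrite !mxE.
by rewrite /shifted_hh; case: ifP => _; rewrite ?rmorph0 ?rmorph_hh.
Qed.
End Functoriality.

Lemma eq_jt_det (R : comNzRingType) (x y : nat -> R) r n n' L :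
  hh x n =1 hh y n' -> jt_det x r n L = jt_det y r n' L.
Proof.
move=> xy; rewrite /jt_det; congr (\det _); apply/matrixP => i j; rewrite !mxE.
by rewrite /shifted_hh; case: ifP => // _; rewrite xy.
Qed.

Lemma eq_hh (R : comNzRingType) (x y : nat -> R) n :
  (forall j, (j < n)%N -> x j = y j) -> hh x n =1 hh y n.
Proof.
elim: n => [//|n IHn] xy k /=; apply: eq_bigr => a _.
by rewrite xy // IHn // => j jn; apply: xy; exact: ltnW.
Qed.

Lemma hhS0 (R : comNzRingType) (x : nat -> R) n : x n = 0 -> hh x n.+1 =1 hh x n.
Proof.
move=> x0 k /=; rewrite big_ord_recl expr0 mul1r subn0 big1 ?addr0 // => a _.
by rewrite x0 expr0n mul0r.
Qed.

Definition xvar n j : {mpoly int[n]} := oapp (fun i : 'I_n => 'X_i) 0 (insub j).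

Lemma mcoeffXM n (m1 m : 'X_{1..n}) (p : {mpoly int[n]}) :
  ('X_[m1] * p)@_m = if (m1 <= m)%MM then p@_(m - m1)%MM else 0.
Proof.
case: ifP => [le|nle].
  by rewrite -{1}(submK le) addmC mulrC mcoeffMX.
rewrite mcoeffM big1 // => -[k1 k2] /= /eqP mE; rewrite mcoeffX.
case: eqP => [e|]; last by rewrite mul0r.
have le1 : (m1 <= (k1 : 'X_{1..n}) + k2)%MM by rewrite e lem_addr.
by rewrite mE le1 in nle.
Qed.

Lemma mcoeff_hsym n k (m : 'X_{1..n}) : (hsym n k)@_m = (mdeg m == k)%:R.
Proof.
rewrite /hsym raddf_sum /=; case: eqP => [mk|mk]; last first.
  rewrite big1 // => a /eqP ak; rewrite mcoeffX; case: eqP => // am.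
  by case: mk; rewrite -am.
have mb : (mdeg m < k.+1)%N by rewrite mk.
rewrite (bigD1 (BMultinom mb)) /= ?mk // mcoeffX eqxx big1 ?addr0 // => a /andP[_ am].
rewrite mcoeffX; case: eqP => // e; case/eqP: am; exact: val_inj.
Qed.

Lemma mcoeff_hh N n k (m : 'X_{1..N}) : (n <= N)%N ->
  (hh (xvar N) n k)@_m =
  ((mdeg m == k) && [forall i : 'I_N, (n <= i)%N ==> (m i == 0%N)])%:R.
Proof.
elim: n k m => [|n IHn] k m nN /=.
  have -> : [forall i : 'I_N, (0 <= i)%N ==> (m i == 0%N)] = (m == 0%MM).
    apply/forallP/eqP => [m0|-> i]; last by rewrite mnmE.
    by apply/mnmP => i; rewrite mnmE; apply/eqP/m0.
  have [->|k0] := eqVneq k 0%N.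
    by rewrite mcoeff1 mdeg_eq0 andbb.
  rewrite mcoeff0; case: eqP => //= mk; case: eqP => // m0.
  by move: k0; rewrite -mk m0 mdeg0.
pose i0 := Ordinal nN.
have xE : xvar N n = 'X_i0 by rewrite /xvar insubT.
rewrite raddf_sum /=.
under eq_bigr => a _.
  rewrite xE mpolyXn mcoeffXM IHn ?(ltnW nN) //.
  over.
have leE a : (U_(i0) *+ a <= m)%MM = (a <= m i0)%N.
  apply/mnm_lepP/idP => [/(_ i0)|h i]; rewrite mulmnE mnm1E ?eqxx ?mul1n //.
  by case: (i0 =P i) => [<-|]; rewrite ?mul1n ?mul0n.
have degE a : (a <= m i0)%N -> mdeg (m - U_(i0) *+ a)%MM = (mdeg m - a)%N.
  rewrite -leE => /submK/(congr1 mdeg).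
  by rewrite mdegD mdegMn mdeg1 mul1n => <-; rewrite addnK.
have degge a : (a <= m i0)%N -> (a <= mdeg m)%N.
  by move=> h; apply: (leq_trans h); rewrite mdegE (bigD1 i0) //= leq_addr.
have vanE a : [forall i : 'I_N, (n <= i)%N ==> ((m - U_(i0) *+ a)%MM i == 0%N)]
    = (m i0 <= a)%N && [forall i : 'I_N, (n < i)%N ==> (m i == 0%N)].
  apply/forallP/andP => [h|[h1 /forallP h2] i].
    split; first by have := h i0; rewrite /= leqnn mnmBE mulmnE mnm1E eqxx mul1n.
    apply/forallP => i; apply/implyP => ni; have := h i; rewrite (ltnW ni) /=.
    rewrite mnmBE mulmnE mnm1E.
    have -> : (i0 == i) = false by rewrite -val_eqE /=; lia.
    by rewrite mul0n subn0.
  apply/implyP => ni; rewrite mnmBE mulmnE mnm1E; case: (i0 =P i) => [<-|ne].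
    by rewrite mul1n subn_eq0.
  rewrite mul0n subn0; have := h2 i; case: ltnP => // ni'; case: ne.
  by apply/val_inj => /=; lia.
have [mk|mk] /= := eqVneq (mdeg m) k; last first.
  rewrite big1 // => a _; rewrite leE; case: ifP => // am.
  rewrite degE // [X in (X && _)](_ : _ = false) //.
  by have := degge _ am; have := ltn_ord a; move/eqP: mk; lia.
have mi0k : (m i0 < k.+1)%N by rewrite ltnS -mk; exact: degge.
rewrite (bigD1 (Ordinal mi0k)) //= leE leqnn degE // mk eqxx vanE leqnn /=.
rewrite big1 ?addr0 // => a; rewrite -val_eqE /= => am.
rewrite leE; case: ifP => // am'; rewrite vanE.
have -> : (m i0 <= a)%N = false by lia.
by rewrite /= andbF.
Qed.

Lemma hsymE n k : hsym n k = hh (xvar n) n k.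
Proof.
apply/mpolyP => m; rewrite mcoeff_hsym mcoeff_hh // [[forall _, _]](_ : _ = true) ?andbT //.
by apply/forallP => i; rewrite leqNgt ltn_ord.
Qed.

Lemma hsym_sym n k : hsym n k \is symmetric.
Proof.
by apply/issymP => s; apply/mpolyP => m; rewrite mcoeff_sym !mcoeff_hsym mdeg_mperm.
Qed.

Lemma restrict_xvar n j : (j <= n)%N -> restrict_last (xvar n.+1 j) = xvar n j.
Proof.
move=> jn; rewrite /xvar insubT /= /restrict_last comp_mpolyXU -tnth_nth tnth_mktuple.
case: unliftP => [i|] /(congr1 val) /=.
  by rewrite /bump leqNgt ltn_ord add0n => ->; rewrite valK.
by move=> ->; rewrite insubF ?ltnn.
Qed.

Lemma restrict_hh n k : restrict_last (hh (xvar n.+1) n.+1 k) = hh (xvar n) n k.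
Proof.
rewrite /restrict_last rmorph_hh -(hhS0 (x := xvar n)); last by rewrite /xvar insubF ?ltnn.
by apply: eq_hh => j jn; exact: restrict_xvar.
Qed.

Lemma is_symfun_hsym k : is_symfun (fun n => hsym n k).
Proof.
split=> [n|n|]; first exact: hsym_sym.
  by rewrite !hsymE restrict_hh.
exists k.+1 => n; rewrite msizeE; apply/bigmax_leqP_seq => m mh _.
by move: mh; rewrite mcoeff_msupp mcoeff_hsym; case: (mdeg m =P k) => [->|_]; rewrite ?ltnSn ?eqxx.
Qed.

Lemma schur_polyE n l : is_partition l ->
  schur_poly n l = jt_det (xvar n) (size l) n (nth 0%N l).
Proof.
move=> /andP[l_sort _].
have Lok : shape_ok (size l) (head 0%N l) (nth 0%N l).
  split=> [i j ij||]; last by rewrite nth0.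
  2: by rewrite nth_default.
  have [jl|jl] := ltnP j (size l); last by rewrite (nth_default _ jl).
  apply: (sorted_leq_nth (leT := geq)) => //.
  - by move=> a b c /= ba ac; exact: leq_trans ac ba.
  - by move=> a /=.
  - by rewrite inE; exact: leq_ltn_trans ij jl.
rewrite -(rect_sum_jt_det _ Lok (leqnn n)) /schur_poly /rect_sum.
pose fw (T : {ffun cell l -> 'I_n}) : {ffun 'I_(size l) * 'I_(head 0%N l) -> 'I_n.+1} :=
  [ffun u => oapp (fun c => widen_ord (leqnSn n) (T c)) ord_max (insub u)].
have fwE T (c : cell l) : fw T (val c) = T c :> nat by rewrite ffunE valK.
have fwN T (u : 'I_(size l) * 'I_(head 0%N l)) : (nth 0%N l u.1 <= u.2)%N -> fw T u = n :> nat.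
  by move=> lu; rewrite ffunE insubF //=; apply/negbTE; rewrite -leqNgt.
have fw_inj : injective fw.
  by move=> T T' e; apply/ffunP => c; apply/val_inj; rewrite /= -!fwE e.
have fw_ss T : rect_ss n (nth 0%N l) (fw T) = semistandard T.
  apply/rect_ssP/andP => [[h1 h2 h3 h4]|[/forallP h3 /forallP h4]].
    split; apply/forallP => -[[i j] cP]; apply/forallP => -[[i' j'] dP] /=.
      apply/implyP => /andP[/eqP ii jj]; subst i'.
      by have := h3 i j j' dP jj; rewrite -!fwE.
    apply/implyP => /andP[/eqP jj ii]; subst j'.
    by have := h4 i i' j cP dP ii; rewrite -!fwE.
  have cellP (u : 'I_(size l) * 'I_(head 0%N l)) : (u.2 < nth 0%N l u.1)%N -> exists c : cell l, u = val c.
    by move=> ul; exists (Sub u ul).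
  split=> [u|u|i j k|i k j].
  - by case/cellP=> c ->; rewrite fwE ltn_ord.
  - exact: fwN.
  - move=> kl jk; have jl := leq_ltn_trans jk kl.
    have [c cE] := cellP (i, j) jl; have [d dE] := cellP (i, k) kl.
    have /forallP/(_ d) := h3 c; rewrite -cE -dE eqxx jk /=.
    by rewrite cE dE !fwE.
  - move=> jl jl' ik.
    have [c cE] := cellP (i, j) jl; have [d dE] := cellP (k, j) jl'.
    have /forallP/(_ d) := h4 c; rewrite -cE -dE eqxx ik /=.
    by rewrite cE dE !fwE.
rewrite [RHS](reindex_omap fw (fun G => [pick T | fw T == G])) /=; last first.
  move=> G /rect_ssP[h1 h2 _ _]; case: pickP => [T /eqP /= -> //|noT].
  pose T : {ffun cell l -> 'I_n} := [ffun c => Ordinal (h1 (val c) (valP c))].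
  case/eqP: (negbT (noT T)); apply/ffunP => u; apply/val_inj => /=.
  have [ul|ul] := ltnP u.2 (nth 0%N l u.1); last by rewrite fwN // h2.
  by rewrite -[u]/(val (Sub u ul : cell l)) fwE ffunE.
apply: eq_big => [T|T _].
  rewrite fw_ss; case: pickP => [T' /eqP /fw_inj ->|/(_ T)]; last by rewrite eqxx.
  by rewrite eqxx andbT.
rewrite (reindex_omap (fun c : cell l => val c) insub) /=; last first.
  by move=> u ul; rewrite insubT.
apply: eq_big => [c|c _]; first by rewrite (valP c) valK eqxx.
by rewrite fwE /xvar valK.
Qed.

Lemma is_symfun_schur l : is_partition l -> is_symfun (fun n => schur_poly n l).
Proof.
move=> lP; split=> [n|n|].
- rewrite schur_polyE //; apply/issymP => s; rewrite rmorph_jt_det.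
  apply: eq_jt_det => k; rewrite -rmorph_hh -hsymE.
  exact: (issymP _ (hsym_sym n k)).
- rewrite !schur_polyE // /restrict_last rmorph_jt_det.
  by apply: eq_jt_det => k; rewrite -rmorph_hh; exact: restrict_hh.
- exists #|cell l|.+1 => n; apply: leq_trans (mmeasure_sum _ _ _ _) _.
  apply/bigmax_leqP => T _.
  rewrite -(big_morph _ (@mpolyXD n int) (mpolyX0 n int)) -/(msize _) msizeX ltnS mdeg_sum.
  by rewrite (eq_bigr (fun=> 1%N)) ?sum1_card // => c _; rewrite mdeg1.
Qed.

Definition symfun_h k : symfun := SymFun (is_symfun_hsym k).
Definition symfun_s (l : intpart) : symfun :=
  SymFun (is_symfun_schur (intpartP l)).

Local Open Scope classical_set_scope.

(* The sigma-algebra on the finite type V is the discrete one, so the events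
   considered are X_k \in A_k for arbitrary subsets A_k of V. *)
Definition mutually_independent (R : realType) (d : measure_display)
    (T : measurableType d) (P : probability T R) (V : finType)
    (X : nat -> T -> V) : Prop :=
  forall (J : seq nat) (A : nat -> {set V}), uniq J ->
    P (\bigcap_(k in [set` J]) [set w | X k w \in A k]) =
    (\big[*%E/1%E]_(k <- J) P [set w | X k w \in A k])%E.

(* Only k > 0 is constrained: h_0 = 1 is sent to 1 by every morphism. *)
Record uniform_random_hom (R : realType) (d : measure_display)
    (T : measurableType d) (P : probability T R) (F : finFieldType)
    (phi : T -> {rmorphism symfun -> F}) : Prop := UniformRandomHom {
  urh_measurable : forall k (a : F), (0 < k)%N ->
    measurable [set w | phi w (symfun_h k) = a];
  urh_uniform : forall k (a : F), (0 < k)%N ->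
    P [set w | phi w (symfun_h k) = a] = (#|F|%:R^-1)%:E;
  urh_independent :
    mutually_independent P (fun k w => phi w (symfun_h k.+1)) }.

(* Main.v *)
Require Import Defs.
From HB Require Import structures.
From mathcomp Require Import all_boot all_algebra zify ring lra.
From mathcomp Require Import mpoly.
From mathcomp Require Import all_classical all_reals all_analysis.

Import GRing.Theory Num.Theory.
Local Open Scope classical_set_scope.
Local Open Scope ring_scope.

(** By Jacobi-Trudi, s_l is the determinant of M = (h_(a_i + j)) with
a_i = l_i - i. Its top right entry t has an index occurring nowhere else in M;
write M = [[u, t], [N, v]]. If N is invertible, exactly one value of t makes M
singular. If N and M are both singular, then [N v] has dependent rows or [u; N]
has dependent columns. It remains to see that, for an m x n matrix of this kind
whose last row is nonzero, a rank below min(m, n) has probability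
O(q^-(1 + |m - n|)). This goes by induction: if the last row is (0, ..., 0, 1),
remove it with the last column; otherwise either N is already rank deficient, or
t is determined by the other entries and, if m < n (resp. m > n), the rows of
[u; N] (resp. the columns of [N v]) are dependent as well. *)

(** * Linear algebra of bordered matrices *)

Section RowDependence.
Local Set Implicit Arguments.
Local Unset Strict Implicit.
Variable F : fieldType.

Lemma row_full_tr m n (A : 'M[F]_(m, n)) : row_full A = row_free A^T.
Proof. by rewrite /row_full /row_free mxrank_tr. Qed.

Lemma row_free_row_mx m n p (A : 'M[F]_(m, n)) (B : 'M[F]_(m, p)) :
  row_free A -> row_free (row_mx A B).
Proof.
move=> Af; apply: inj_row_free => w; rewrite mul_mx_row => /eqP.
by rewrite row_mx_eq0 => /andP[/eqP wA _]; apply: (row_free_inj Af); rewrite wA mul0mx.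
Qed.

(** A vanishing combination of the rows of [col_mx u A] has a nonzero coefficient at [u], since the
    rows of [A] are independent; dividing by it expresses [u]. *)
Lemma row_dependence m n (u : 'rV[F]_n) (A : 'M[F]_(m, n)) :
  row_free A -> ~~ row_free (col_mx u A) -> exists w, u = w *m A.
Proof.
move=> Af; apply: contraNP => nw; apply: inj_row_free => w.
have l11 := mx11_scalar (lsubmx w); set a := lsubmx w 0 0 in l11.
rewrite -[w in w *m _]hsubmxK mul_row_col l11 mul_scalar_mx => wE.
have [a0|a0] := eqVneq a 0.
  move: wE; rewrite a0 scale0r add0r => wA.
  have r0 : rsubmx w = 0 by apply: (row_free_inj Af); rewrite wA mul0mx.
  by rewrite -[w]hsubmxK l11 a0 r0 raddf0 row_mx0.
case: nw; exists (- a^-1 *: rsubmx w).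
have auE : a *: u = - (rsubmx w *m A) by apply/eqP; rewrite -addr_eq0 wE.
by rewrite -scalemxAl scaleNr -scalerN -auE scalerA mulVf ?scale1r.
Qed.

Lemma row_dependence_down m n (u : 'rV[F]_n) (A : 'M[F]_(m, n)) :
  row_free A -> ~~ row_free (col_mx A u) -> exists w, u = w *m A.
Proof.
move=> Af; suff e : row_free (col_mx A u) = row_free (col_mx u A).
  by rewrite e; exact: row_dependence.
by rewrite /row_free -!addsmxE addsmxC addnC.
Qed.

Lemma row_free_block1 m n (A : 'M[F]_(m, n)) (v : 'cV[F]_m) :
  row_free A -> row_free (block_mx A v 0 (1%:M : 'M[F]_1)).
Proof.
move=> Af; apply: inj_row_free => w.
rewrite -[w in w *m _]hsubmxK mul_row_block mulmx0 addr0 mulmx1.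
move/eqP; rewrite row_mx_eq0 => /andP[/eqP wA /eqP].
have l0 : lsubmx w = 0 by apply: (row_free_inj Af); rewrite wA mul0mx.
by rewrite l0 mul0mx add0r => r0; rewrite -[w]hsubmxK l0 r0 row_mx0.
Qed.

Lemma row_full_block1 m n (A : 'M[F]_(m, n)) (v : 'cV[F]_m) :
  row_full A -> row_full (block_mx A v 0 (1%:M : 'M[F]_1)).
Proof.
rewrite !row_full_tr => Af; apply: inj_row_free => w.
rewrite tr_block_mx trmx0 trmx1 -[w in w *m _]hsubmxK mul_row_block mulmx0 add0r mulmx1.
move/eqP; rewrite row_mx_eq0 => /andP[/eqP wA /eqP r0].
move: wA; rewrite r0 mul0mx addr0 => wA.
have l0 : lsubmx w = 0 by apply: (row_free_inj Af); rewrite wA mul0mx.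
by rewrite -[w]hsubmxK l0 r0 row_mx0.
Qed.

Section Corner.
Variables m n : nat.
Variables (u : 'rV[F]_n) (t : 'rV[F]_1) (N : 'M[F]_(m, n)) (v : 'cV[F]_m).
Let M := col_mx (row_mx u t) (row_mx N v).

(** Independence of the rows of [N] passes to [N v], so the first row of [M] is a combination of the
    others; [t] can then be read off from [u], [N] and [v]. *)
Lemma corner_row : row_free N -> ~~ row_free M ->
  exists2 w, u = w *m N & t = w *m v.
Proof.
move=> Nf /(row_dependence (row_free_row_mx v Nf))[w].
by rewrite mul_mx_row => /eq_row_mx[-> ->]; exists w.
Qed.

Lemma corner_col : row_full N -> ~~ row_full M ->
  exists2 w, v = N *m w & t = u *m w.
Proof.
rewrite !row_full_tr /M tr_col_mx !tr_row_mx -block_mxEh => Nf.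
have Nf' : row_free (row_mx u^T N^T).
  apply: inj_row_free => w; rewrite mul_mx_row => /eqP.
  by rewrite row_mx_eq0 => /andP[_ /eqP wN]; apply: (row_free_inj Nf); rewrite wN mul0mx.
move=> /(row_dependence_down Nf')[w].
rewrite mul_mx_row => /eq_row_mx[tE vE]; exists w^T.
  by rewrite -[v]trmxK vE trmx_mul trmxK.
by rewrite -[t]trmxK tE trmx_mul trmxK.
Qed.

(** If the rows of [N v] are independent, a dependence in [M] puts its first row in their span. Then
    [u] lies in the row space of [N], and adding it does not raise the deficient rank. *)
Lemma singular_corner : m = n -> ~~ row_free N -> ~~ row_free M ->
  row_free (row_mx N v) -> ~~ row_full (col_mx u N).
Proof.
move=> mn Ns Ms /row_dependence/(_ Ms)[w]; rewrite mul_mx_row => /eq_row_mx[uE _].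
apply: contra Ns; rewrite /row_full /row_free -addsmxE.
have /addsmx_idPr -> : (u <= N)%MS by rewrite uE submxMl.
by move=> /eqP ->; apply/eqP.
Qed.
End Corner.

End RowDependence.

(** * Counting along the lines parallel to a coordinate axis *)

Section Lines.
Local Set Implicit Arguments.
Local Unset Strict Implicit.
Local Open Scope nat_scope.
Local Open Scope set_scope.
Variables (I F : finType).
Implicit Types x y : {ffun I -> F}.
Implicit Types E B : {set {ffun I -> F}}.

Definition upd k x t : {ffun I -> F} := [ffun i => if i == k then t else x i].

Definition agree_off k x y := forall i, i != k -> x i = y i.

Lemma agree_upd k x t : agree_off k x (upd k x t).
Proof. by move=> i ik; rewrite ffunE (negPf ik). Qed.

Lemma upd_k k x t : upd k x t k = t. Proof. by rewrite ffunE eqxx. Qed.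

(** The hypothesis says that [E] meets each line parallel to the [k]-th axis at most once, so a
    point of [E] is recovered from its line. *)
Lemma upd_inj k E : {in E &, forall x y, agree_off k x y -> x k = y k} ->
  {in finset.setX E [set: F] &, injective (fun p => upd k p.1 p.2)}.
Proof.
move=> Einj [x s] [y t]; rewrite !inE !andbT /= => xE yE e.
have st : s = t by rewrite -(upd_k k x s) e upd_k.
have xy : agree_off k x y.
  by move=> i ik; rewrite (agree_upd x s ik) e -(agree_upd y t ik).
congr pair => //; apply/ffunP => i; have [->|] := eqVneq i k; last exact: xy.
exact: Einj.
Qed.

(** The lines through the points of [E] are disjoint, have [#|F|] points each and lie in [B]. *)
Lemma card_lines_le k E B :
  {in E, forall x y, agree_off k x y -> y \in B} ->
  {in E &, forall x y, agree_off k x y -> x k = y k} ->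
  #|E| * #|F| <= #|B|.
Proof.
move=> EB Einj; rewrite -(finset.cardsT F) -finset.cardsX -(card_in_imset (upd_inj Einj)).
apply: subset_leq_card; apply/fintype.subsetP => _ /imsetP[[x t] /= xE ->].
by move: xE; rewrite !inE andbT => xE; apply: (EB x) => //; exact: agree_upd.
Qed.

(** By the third hypothesis the lines through [E] also cover [B]. *)
Lemma card_lines_eq k E B :
  {in E, forall x y, agree_off k x y -> y \in B} ->
  {in E &, forall x y, agree_off k x y -> x k = y k} ->
  {in B, forall x, exists2 y, y \in E & agree_off k y x} ->
  #|E| * #|F| = #|B|.
Proof.
move=> EB Einj BE; apply/eqP; rewrite eqn_leq (card_lines_le EB Einj) /=.
rewrite -(finset.cardsT F) -finset.cardsX -(card_in_imset (upd_inj Einj)).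
apply: subset_leq_card; apply/fintype.subsetP => x /BE[y yE yx].
apply/imsetP; exists (y, x k); first by rewrite !inE yE.
apply/ffunP => i; rewrite ffunE /=; case: eqP => [->//|/eqP ik].
by rewrite yx.
Qed.

End Lines.

(** * Counting rank-deficient matrices with entries h_(a_i + j) over a finite field *)

Section HankelCount.
Local Set Implicit Arguments.
Local Unset Strict Implicit.
Local Open Scope nat_scope.
Local Open Scope set_scope.
Variables (K s : nat) (F : finFieldType).
Implicit Types (x y : {ffun 'I_K -> F}) (b : nat -> nat).

(* The value of h_k when h_1, ..., h_K are sent to the entries of x. *)
Definition hval x k : F :=
  if k is k'.+1 then oapp (fun i => x i) 0%R (insub k' : option 'I_K) else 1%R.

(* Indices are shifted by s so that they stay in nat: shifted_h x m stands for
   h_(m - s), which vanishes for m < s. *)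
Definition shifted_h x m : F := if (m < s) then 0%R else hval x (m - s).

(** Arbitrary row offsets [b] make the family closed under passing to the blocks used below:
    [drop_row] gives the offsets without the first row, [drop_cols] those to the right of the first
    [n] columns. *)
Definition hmx b m n x : 'M[F]_(m, n) := \matrix_(i < m, j < n) shifted_h x (b i + j).

Definition drop_row b i := b i.+1.
Definition drop_cols b n i := (b i + n).

Lemma hmx_col_mx b m n x :
  hmx b m.+1 n x = col_mx (hmx b 1 n x) (hmx (drop_row b) m n x).
Proof.
apply/matrixP => i j; rewrite !mxE; case: splitP => k ik; rewrite !mxE.
  by rewrite ik.
by rewrite ik.
Qed.

Lemma hmx_row_mx b m n x :
  hmx b m (n + 1) x = row_mx (hmx b m n x) (hmx (drop_cols b n) m 1 x).
Proof.
apply/matrixP => i j; rewrite !mxE; case: splitP => k ik; rewrite !mxE ik //.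
by rewrite /drop_cols addnA.
Qed.

(** The bottom right entry is h_0 = 1, and the entries to its left have negative index. *)
Lemma hmx_last b m n x : (b m + n = s) ->
  hmx b (m + 1) (n + 1) x =
  block_mx (hmx b m n x) (hmx (drop_cols b n) m 1 x) 0%R (1%:M)%R.
Proof.
move=> bE; apply/matrixP => i j; rewrite !mxE.
case: splitP => k ->; rewrite !mxE; case: splitP => l ->; rewrite !mxE ?addnA //.
  rewrite [k]ord1 addn0 /shifted_h ifT // -bE ltn_add2l //.
by rewrite [k]ord1 [l]ord1 !addn0 bE /shifted_h ltnn subnn.
Qed.

(** Coordinate [k] stores the value of h_(k+1), whose shifted index is [(s + k).+1]. *)
Lemma shifted_h_agree k x y m : agree_off k x y -> m != (s + k).+1 -> shifted_h x m = shifted_h y m.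
Proof.
move=> xy mk; rewrite /shifted_h; case: ltnP => // sm; rewrite /hval.
case E : (m - s) => [//|i]; case: insubP => //= j _ jE; apply: xy.
by apply: contraNneq mk => <-; rewrite jE; lia.
Qed.

Lemma shifted_h_top x (k : 'I_K) : shifted_h x (s + k).+1 = x k.
Proof.
rewrite /shifted_h ifF; last by lia.
have -> : ((s + k).+1 - s = k.+1) by lia.
by rewrite /hval valK.
Qed.

Lemma hmx_agree k x y b m n : agree_off k x y ->
  (forall i j, (i < m) -> (j < n) -> (b i + j) != (s + k).+1) ->
  hmx b m n x = hmx b m n y.
Proof. by move=> xy bk; apply/matrixP => i j; rewrite !mxE (shifted_h_agree xy) ?bk. Qed.

(* The second condition says that the last row is nonzero, the third one that
   only h_0, ..., h_K occur. *)
Definition hshape b m n :=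
  [/\ forall i, (i.+1 < m) -> (b i.+1 < b i),
      (0 < m) -> (s < b m.-1 + n)
    & forall i, (i < m) -> (b i + n <= (s + K).+1)].

Lemma hshape_lt b m n i : hshape b m n -> (0 < i < m) -> (b i < b 0).
Proof.
case=> bS _ _; elim: i => // i IHi /andP[_ im].
apply: leq_trans (bS i im) _; have [->//|i0] := posnP i.
by rewrite ltnW // IHi // i0 ltnW.
Qed.

Lemma hshape_drop_row b m n : hshape b m.+1 n -> hshape (drop_row b) m n.
Proof.
case=> bS bl bK; split=> [i im|m0|i im]; [exact: bS | | exact: bK].
by case: m m0 bl {bS bK} => // m _ bl; exact: bl.
Qed.

Lemma hshape_narrow b m n : (s < b m + n) -> hshape b m.+1 n.+1 -> hshape b m.+1 n.
Proof.
move=> sb [bS _ bK]; split=> // i im.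
by apply: leq_trans (bK i im); rewrite leq_add2l.
Qed.

Lemma hshape_corner b m n : (s < b m + n) -> hshape b m.+1 n.+1 -> hshape (drop_row b) m n.
Proof. by move=> sb bP; apply: hshape_drop_row; exact: hshape_narrow. Qed.

Lemma hshape_last b m n : (b m + n = s) -> hshape b m.+1 n.+1 -> hshape b m n.
Proof.
move=> sb [bS _ bK]; split=> [i im|m0|i im]; first by apply: bS; exact: ltnW.
  by have := bS m.-1; rewrite prednK // => /(_ (ltnSn _)); lia.
by have := bK i (ltnW im); lia.
Qed.

Definition bad_row b m n := [set x | ~~ row_free (hmx b m n x)].
Definition bad_col b m n := [set x | ~~ row_full (hmx b m n x)].

Lemma hmx_corner b m n x : hmx b m.+1 (n + 1) x =
  col_mx (row_mx (hmx b 1 n x) (hmx (drop_cols b n) 1 1 x))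
         (row_mx (hmx (drop_row b) m n x) (hmx (drop_cols (drop_row b) n) m 1 x)).
Proof. by rewrite hmx_col_mx !hmx_row_mx. Qed.

Lemma row_free_corner b m n x : row_free (hmx b m.+1 n.+1 x) =
  row_free (col_mx (row_mx (hmx b 1 n x) (hmx (drop_cols b n) 1 1 x))
    (row_mx (hmx (drop_row b) m n x) (hmx (drop_cols (drop_row b) n) m 1 x))).
Proof. by rewrite -hmx_corner addn1. Qed.

(** The top right entry is one of the free values h_1, ..., h_K: its index is positive because
    [b m <= b 0], and the third condition of [hshape] bounds it. *)
Lemma top_index b m n : hshape b m.+1 n.+1 -> s < b m + n ->
  exists k : 'I_K, b 0 + n = (s + k).+1.
Proof.
move=> bP sb; have [_ _ /(_ 0 isT) bK] := bP.
have b0 : b m <= b 0.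
  by have [->//|m0] := posnP m; rewrite ltnW // (hshape_lt (i := m) bP) // m0 /=.
have kK : b 0 + n - s.+1 < K by lia.
by exists (Ordinal kK) => /=; lia.
Qed.

(** * Dependence on the top right entry *)

Section TopEntry.
Variables (b : nat -> nat) (m n : nat) (k : 'I_K).
Hypotheses (bP : hshape b m.+1 n.+1) (kE : b 0 + n = (s + k).+1).

Lemma hmx_top x : hmx (drop_cols b n) 1 1 x = ((x k)%:M)%R.
Proof. by apply/matrixP => i j; rewrite !mxE !ord1 eqxx /drop_cols !addn0 kE shifted_h_top. Qed.

(** Row offsets decrease strictly, so all indices in the lower rows stay below that of the top right
    entry. *)
Lemma agree_lower x y p : agree_off k x y -> p <= n.+1 ->
  hmx (drop_row b) m p x = hmx (drop_row b) m p y.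
Proof.
move=> xy pn; apply: hmx_agree xy _ => i j im jp; rewrite -kE.
by have := @hshape_lt b m.+1 n.+1 i.+1 bP; rewrite /drop_row /= ltnS => /(_ im); lia.
Qed.

Lemma agree_lower_col x y : agree_off k x y ->
  hmx (drop_cols (drop_row b) n) m 1 x = hmx (drop_cols (drop_row b) n) m 1 y.
Proof.
move=> xy; apply: hmx_agree xy _ => i j im jp; rewrite -kE.
by have := @hshape_lt b m.+1 n.+1 i.+1 bP; rewrite /drop_cols /drop_row /= ltnS => /(_ im); lia.
Qed.

Lemma agree_left x y p : agree_off k x y -> p <= m.+1 -> hmx b p n x = hmx b p n y.
Proof.
move=> xy pm; apply: hmx_agree xy _ => i j im jn; rewrite -kE.
have [->|i0] := posnP i; first by lia.
by have := @hshape_lt b m.+1 n.+1 i bP; rewrite i0 /= => /(_ (leq_trans im pm)); lia.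
Qed.

(* The rank deficiencies caused by the first row and last column only. *)
Definition top_row := bad_row b m.+1 n.+1 :\: bad_row (drop_row b) m n.
Definition top_col := bad_col b m.+1 n.+1 :\: bad_col (drop_row b) m n.

Lemma top_rowP x : x \in top_row -> row_free (hmx (drop_row b) m n x) /\
  exists2 w, hmx b 1 n x = (w *m hmx (drop_row b) m n x)%R
    & hmx (drop_cols b n) 1 1 x = (w *m hmx (drop_cols (drop_row b) n) m 1 x)%R.
Proof.
rewrite !inE negbK => /andP[Nf Mb]; split=> //; apply: corner_row => //.
by rewrite row_free_corner in Mb.
Qed.

Lemma top_colP x : x \in top_col -> row_full (hmx (drop_row b) m n x) /\
  exists2 w, hmx (drop_cols (drop_row b) n) m 1 x = (hmx (drop_row b) m n x *m w)%R
    & hmx (drop_cols b n) 1 1 x = (hmx b 1 n x *m w)%R.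
Proof.
rewrite !inE negbK => /andP[Nf Mb]; split=> //; apply: corner_col => //.
by move: Mb; rewrite -[n.+1]addn1 hmx_corner.
Qed.

(** Points on one line share u, N and v. As N has independent rows, u = wN determines w, and hence t
    = wv. *)
Lemma top_row_unique : {in top_row &, forall x y, agree_off k x y -> x k = y k}.
Proof.
move=> x y /top_rowP[Nf [w uw tw]] /top_rowP[_ [w' uw' tw']] xy.
move: tw tw' uw'; rewrite -(agree_lower xy (leqnSn n)) -(agree_left xy) // -(agree_lower_col xy).
rewrite uw !hmx_top => tw tw' /(row_free_inj Nf) ww'.
by move: tw'; rewrite -ww' -tw => /matrixP/(_ ord0 ord0); rewrite !mxE eqxx.
Qed.

Lemma top_col_unique : {in top_col &, forall x y, agree_off k x y -> x k = y k}.
Proof.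
move=> x y /top_colP[Nf [w vw tw]] /top_colP[_ [w' vw' tw']] xy.
move: tw tw' vw'; rewrite -(agree_lower xy (leqnSn n)) -(agree_left xy) // -(agree_lower_col xy).
rewrite vw !hmx_top => tw tw' /(row_full_inj Nf) ww'.
by move: tw'; rewrite -ww' -tw => /matrixP/(_ ord0 ord0); rewrite !mxE eqxx.
Qed.

(** The relation u = wN makes the rows of [u; N] dependent, and this block does not contain the top
    right entry, so the whole line is bad. *)
Lemma top_row_left : m < n ->
  {in top_row, forall x y, agree_off k x y -> y \in bad_row b m.+1 n}.
Proof.
move=> mn x /top_rowP[Nf [w uw _]] y xy; rewrite inE -(agree_left xy) // hmx_col_mx uw.
rewrite /row_free -[\rank _]/(\rank (col_mx (w *m hmx (drop_row b) m n x)%R _)) -addsmxE; have /addsmx_idPr -> := submxMl w (hmx (drop_row b) m n x).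
by rewrite neq_ltn ltnS rank_leq_row.
Qed.

Lemma top_col_lower : n < m ->
  {in top_col, forall x y, agree_off k x y -> y \in bad_col (drop_row b) m n.+1}.
Proof.
move=> nm x /top_colP[Nf [w vw _]] y xy; rewrite inE -(agree_lower xy) //.
rewrite -addn1 hmx_row_mx vw /row_full -mxrank_tr tr_row_mx -addsmxE trmx_mul.
have /addsmx_idPl -> := submxMl w^T (hmx (drop_row b) m n x)^T.
by rewrite mxrank_tr neq_ltn addn1 ltnS rank_leq_col.
Qed.

End TopEntry.

(** The probability bound q^-(1 + n - m), cleared of denominators. The constant doubles with each
    row or column to absorb the two cases of the induction. *)
Lemma bad_row_count b m n : m <= n -> hshape b m n ->
  #|bad_row b m n| * #|F| ^ (n - m).+1 <= 2 ^ (m + n) * #|{ffun 'I_K -> F}|.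
Proof.
have [N] := ubnP (m + n); elim: N => // N IH in b m n *.
case: m => [|m] mnN mn bP.
  rewrite (_ : bad_row _ _ _ = finset.set0) ?cards0 //.
  by apply/finset.setP => x; rewrite !inE /row_free -leqn0 rank_leq_row.
case: n => // n in mnN mn bP *.
have [_ /(_ isT) /= sb _] := bP.
(* If the last row is (0, ..., 0, 1), deleting it with the last column keeps n - m, and independent
   rows in what remains would give independent rows in the whole. *)
have [sE|sN] := eqVneq (b m + n) s.
  have /IH : m + n < N by lia.
  move=> /(_ b mn (hshape_last sE bP)) IHb.
  apply: (@leq_trans (#|bad_row b m n| * #|F| ^ (n - m).+1)).
    rewrite leq_mul2r subset_leq_card ?orbT //; apply/fintype.subsetP => x.
    rewrite !inE; apply: contra => /(row_free_block1 (hmx (drop_cols b n) m 1 x)).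
    by rewrite -hmx_last // !addn1.
  by apply: leq_trans IHb _; rewrite leq_mul2r leq_exp2l ?orbT //; lia.
have {sb sN} sb : s < b m + n by lia.
have [k kE] := top_index bP sb.
have IH1 : #|bad_row (drop_row b) m n| * #|F| ^ (n - m).+1
    <= 2 ^ (m + n) * #|{ffun 'I_K -> F}|.
  by apply: IH => //; [lia|exact: hshape_corner].
have IH2 : #|top_row b m n| * #|F| ^ (n - m).+1
    <= 2 ^ (m.+1 + n) * #|{ffun 'I_K -> F}|.
  have [?|mn'] := eqVneq m n; first subst m.
    (* For m = n a single factor [#|F|] is required, and one bad point per line provides it. *)
    rewrite subnn expn1; apply: leq_trans (leq_pmull _ (expn_gt0 2 _)).
    rewrite -(finset.cardsT {ffun 'I_K -> F}); apply: (card_lines_le _ (top_row_unique bP kE)) => x _ y _.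
    by rewrite inE.
  have {}mn' : m < n by lia.
  (* For m < n one factor [#|F|] comes from the lines; the other n - m come from induction on
     [u; N], which contains these lines in its bad set. *)
  rewrite expnS mulnA (_ : n - m = (n - m.+1).+1); last by lia.
  apply: leq_trans (IH b m.+1 n _ _ _); [|lia|by []|exact: hshape_narrow].
  rewrite leq_mul2r; apply/orP; right.
  exact: card_lines_le (top_row_left bP kE mn') (top_row_unique bP kE).
rewrite -(cardsID (bad_row (drop_row b) m n)) subSS mulnDl.
apply: leq_trans (leq_add (leq_trans _ IH1) IH2) _.
  by rewrite leq_mul2r subset_leq_card ?orbT ?subsetIr.
rewrite -mulnDl leq_mul2r; apply/orP; right.
by rewrite !addSn ?addnS !expnS; lia.
Qed.

(** The column version of [bad_row_count]: for n < m the induction runs on [N v] instead of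
    [u; N]. *)
Lemma bad_col_count b m n : n <= m -> hshape b m n ->
  #|bad_col b m n| * #|F| ^ (m - n).+1 <= 2 ^ (m + n) * #|{ffun 'I_K -> F}|.
Proof.
have [N] := ubnP (m + n); elim: N => // N IH in b m n *.
case: n => [|n] mnN mn bP.
  rewrite (_ : bad_col _ _ _ = finset.set0) ?cards0 //.
  by apply/finset.setP => x; rewrite !inE /row_full -leqn0 rank_leq_col.
case: m => // m in mnN mn bP *.
have [_ /(_ isT) /= sb _] := bP.
have [sE|sN] := eqVneq (b m + n) s.
  have /IH : m + n < N by lia.
  move=> /(_ b mn (hshape_last sE bP)) IHb.
  apply: (@leq_trans (#|bad_col b m n| * #|F| ^ (m - n).+1)).
    rewrite leq_mul2r subset_leq_card ?orbT //; apply/fintype.subsetP => x.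
    rewrite !inE; apply: contra => /(row_full_block1 (hmx (drop_cols b n) m 1 x)).
    by rewrite -hmx_last // !addn1.
  by apply: leq_trans IHb _; rewrite leq_mul2r leq_exp2l ?orbT //; lia.
have {sb sN} sb : s < b m + n by lia.
have [k kE] := top_index bP sb.
have IH1 : #|bad_col (drop_row b) m n| * #|F| ^ (m - n).+1
    <= 2 ^ (m + n) * #|{ffun 'I_K -> F}|.
  by apply: IH => //; [lia|exact: hshape_corner].
have IH2 : #|top_col b m n| * #|F| ^ (m - n).+1
    <= 2 ^ (m + n.+1) * #|{ffun 'I_K -> F}|.
  have [?|mn'] := eqVneq m n; first subst m.
    rewrite subnn expn1; apply: leq_trans (leq_pmull _ (expn_gt0 2 _)).
    rewrite -(finset.cardsT {ffun 'I_K -> F}); apply: (card_lines_le _ (top_col_unique bP kE)) => x _ y _.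
    by rewrite inE.
  have {}mn' : n < m by lia.
  rewrite expnS mulnA (_ : m - n = (m - n.+1).+1); last by lia.
  apply: leq_trans (IH (drop_row b) m n.+1 _ _ _); [|lia|by []|exact: hshape_drop_row].
  rewrite leq_mul2r; apply/orP; right.
  exact: card_lines_le (top_col_lower bP kE mn') (top_col_unique bP kE).
rewrite -(cardsID (bad_col (drop_row b) m n)) subSS mulnDl.
apply: leq_trans (leq_add (leq_trans _ IH1) IH2) _.
  by rewrite leq_mul2r subset_leq_card ?orbT ?subsetIr.
rewrite -mulnDl leq_mul2r; apply/orP; right.
by rewrite !addSn ?addnS !expnS; lia.
Qed.

(** With N invertible, setting t = u N^-1 v makes the first row a combination of the others. *)
Lemma top_row_exists b m (k : 'I_K) : hshape b m.+1 m.+1 -> b 0 + m = (s + k).+1 ->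
  {in ~: bad_row (drop_row b) m m, forall x, exists2 y, y \in top_row b m m & agree_off k y x}.
Proof.
move=> bP kE x; rewrite !inE negbK => Nf.
pose N := hmx (drop_row b) m m x; pose w := (hmx b 1 m x *m invmx N)%R.
pose y := upd k x ((w *m hmx (drop_cols (drop_row b) m) m 1 x)%R ord0 ord0).
have xy : agree_off k x y by exact: agree_upd.
exists y; last by move=> i ik; rewrite xy.
rewrite !inE -(agree_lower bP kE xy (leqnSn m)) Nf /=.
rewrite row_free_corner -(agree_lower bP kE xy (leqnSn m)).
rewrite -(agree_left bP kE xy) // -(agree_lower_col bP kE xy) (hmx_top kE) upd_k -mx11_scalar.
have Nu : N \in unitmx by rewrite -row_free_unit.
rewrite -[hmx b 1 m x](mulmxKV Nu) -/N -/w -mul_mx_row.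
rewrite /row_free -addsmxE; have /addsmx_idPr -> := submxMl w (row_mx N (hmx (drop_cols (drop_row b) m) m 1 x)).
by rewrite neq_ltn ltnS rank_leq_row.
Qed.

(** Divided by [Q * #|F| ^ 2], the two bounds say that the proportion of singular matrices differs
    from 1/q by at most C/q^2. *)
Lemma square_count b m (Q := #|{ffun 'I_K -> F}|) (C := 2 ^ (m + m).+2) :
  hshape b m.+1 m.+1 -> s < b m + m ->
  #|bad_row b m.+1 m.+1| * #|F| ^ 2 <= Q * #|F| + C * Q /\
  Q * #|F| <= #|bad_row b m.+1 m.+1| * #|F| ^ 2 + C * Q.
Proof.
move=> bP sb; have [k kE] := top_index bP sb.
pose B := bad_row (drop_row b) m m; pose E := bad_row b m.+1 m.+1.
have Bc : #|B| * #|F| <= 2 ^ (m + m) * Q.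
  by have := bad_row_count (leqnn m) (hshape_corner sb bP); rewrite subnn.
(* Each line on which N is invertible contains exactly one singular matrix. *)
have top : #|top_row b m m| * #|F| = Q - #|B|.
  rewrite (card_lines_eq (B := ~: B) (k := k)).
  - by rewrite cardsCs finset.setCK.
  - by move=> x /top_rowP[Nf _] y xy; rewrite !inE -(agree_lower bP kE xy (leqnSn m)) Nf.
  - exact: top_row_unique.
  - exact: top_row_exists.
have BQ : #|B| <= Q by exact: max_card.
have EB : #|E :&: B| * #|F| ^ 2 <= C * Q.
  (* Both rectangles differ from a square by one row or column, so each count gains [#|F| ^ 2]; [C]
     is the sum of their two constants. *)
  have EBs : E :&: B \subset bad_row (drop_row b) m m.+1 :|: bad_col b m.+1 m.
    apply/fintype.subsetP => x; rewrite !inE -implybE => /andP[Mb Nb].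
    apply/implyP => Nf; rewrite hmx_col_mx.
    apply: (singular_corner (t := hmx (drop_cols b m) 1 1 x)
              (v := hmx (drop_cols (drop_row b) m) m 1 x) _ Nb) => //.
      by rewrite row_free_corner in Mb.
    by move: Nf; rewrite -[m.+1]addn1 hmx_row_mx.
  have c1 := bad_row_count (leqnSn m) (hshape_drop_row bP).
  have c2 := bad_col_count (leqnSn m) (hshape_narrow sb bP).
  rewrite subSn // subnn in c1; rewrite subSn // subnn in c2.
  apply: leq_trans (leq_mul (subset_leq_card EBs) (leqnn _)) _.
  apply: leq_trans (leq_mul (leq_card_setU _ _) (leqnn _)) _.
  rewrite mulnDl; apply: leq_trans (leq_add c1 c2) _.
  by rewrite /C addnS addSn !expnS; lia.
have -> : #|E| * #|F| ^ 2 = #|E :&: B| * #|F| ^ 2 + (Q - #|B|) * #|F|.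
  by rewrite -(cardsID B) mulnDl -top -mulnA.
have CB : #|B| * #|F| <= C * Q.
  by apply: leq_trans Bc _; rewrite leq_mul2r leq_exp2l //; apply/orP; right; lia.
rewrite mulnBl; have : #|B| * #|F| <= Q * #|F| by rewrite leq_mul2r BQ orbT.
by move: EB CB; move: (_ * _) (_ * _) (_ * _) (_ * _) => *; lia.
Qed.

Lemma det_hmx_eq0 b r x : \det (hmx b r r x) = 0%R <-> x \in bad_row b r r.
Proof. by rewrite inE row_free_unit unitmxE unitfE negbK; exact: rwP eqP. Qed.

End HankelCount.

(** * The Jacobi-Trudi identity in the ring of symmetric functions *)

Section JacobiTrudi.
Local Set Implicit Arguments.
Local Unset Strict Implicit.

Lemma nth_partition (l : intpart) i j : (i <= j)%N -> (nth 0 l j <= nth 0 l i)%N.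
Proof.
have /andP[l_sort _] := intpartP l => ij.
have [jl|jl] := ltnP j (size l); last by rewrite (nth_default _ jl).
apply: (sorted_leq_nth (leT := geq)); rewrite ?inE ?(leq_ltn_trans ij) //.
  by move=> a b c /= ba ac; exact: leq_trans ac ba.
by move=> a; exact: leqnn.
Qed.

Lemma nth_partition_gt0 (l : intpart) i : (i < size l)%N -> (0 < nth 0 l i)%N.
Proof.
have /andP[_ l0] := intpartP l => il.
by rewrite lt0n; apply: contraNneq l0 => <-; exact: mem_nth.
Qed.

(** Named so that projection to n variables can carry a ring morphism structure and commute with
    determinants. *)
Definition symfun_at n (f : symfun) := f n.

Lemma symfun_at_zmod n : zmod_morphism (symfun_at n).
Proof. by []. Qed.
Lemma symfun_at_monoid n : monoid_morphism (symfun_at n).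
Proof. by []. Qed.

HB.instance Definition _ n := GRing.isZmodMorphism.Build symfun _ (symfun_at n) (symfun_at_zmod n).
HB.instance Definition _ n := GRing.isMonoidMorphism.Build symfun _ (symfun_at n) (symfun_at_monoid n).

(** This is l_i - i, raised by the number of rows to stay in nat. *)
Definition row_start (l : seq nat) i := (nth 0 l i + (size l - i))%N.

Lemma jacobi_trudi (l : intpart) : symfun_s l =
  \det (\matrix_(i < size l, j < size l)
    if (row_start l i + j < size l)%N then 0 else symfun_h (row_start l i + j - size l)).
Proof.
apply: symfun_ext => n; rewrite /= schur_polyE; last exact: intpartP.
rewrite -/(symfun_at n (\det _)) -det_map_mx; congr (\det _).
apply/matrixP => i j; rewrite !mxE /shifted_hh -/(row_start l i).
by case: ifP => _; rewrite ?rmorph0 //= -hsymE.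
Qed.

Lemma hh0 (A : comNzRingType) (x : nat -> A) n : hh x n 0 = 1.
Proof. by elim: n => //= n IHn; rewrite big_ord1 expr0 mul1r IHn. Qed.

Lemma symfun_h0 : symfun_h 0 = 1.
Proof. by apply: symfun_ext => n; rewrite /= hsymE hh0. Qed.

(** All indices in the matrix are below [head 0 l + size l], so the images of h_1, ..., h_K
    determine that of s_l. *)
Lemma rmorph_symfun_s (F : finFieldType) (f : {rmorphism symfun -> F}) (l : intpart) K :
  (head 0 l + size l <= K)%N ->
  f (symfun_s l) = \det (hmx (size l) (row_start l) (size l) (size l)
     [ffun k : 'I_K => f (symfun_h k.+1)]).
Proof.
move=> lK; rewrite jacobi_trudi -det_map_mx; congr (\det _).
apply/matrixP => i j; rewrite !mxE /shifted_h; case: ifP => ij; first by rewrite rmorph0.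
have li : (nth 0 l i <= head 0 l)%N.
  by rewrite -nth0 nth_partition.
rewrite /hval; case E: (_ - _)%N => [|k]; first by rewrite symfun_h0 rmorph1.
have kK : (k < K)%N by move: E; rewrite /row_start; have := ltn_ord j; lia.
by rewrite (insubT (fun k => k < K)%N kK) /= ffunE.
Qed.
Lemma hshape_row_start (l : intpart) m : size l = m.+1 ->
  hshape (head 0 l + size l)%N (size l) (row_start l) m.+1 m.+1.
Proof.
move=> lm; split=> [i im|_ /=|i im]; rewrite /row_start lm.
- by have := nth_partition l (leqnSn i); lia.
- by lia.
- by have := nth_partition l (leq0n i); rewrite nth0; lia.
Qed.

End JacobiTrudi.

(** * The joint law of the images of h_1, ..., h_K *)

Section UniformHom.
Local Set Implicit Arguments.
Local Unset Strict Implicit.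
Variables (R : realType) (d : measure_display) (T : measurableType d).
Variables (P : probability T R) (F : finFieldType) (phi : T -> {rmorphism symfun -> F}).
Hypothesis phiP : uniform_random_hom P phi.
Variable K : nat.

Definition hvec w : {ffun 'I_K -> F} := [ffun k : 'I_K => phi w (symfun_h k.+1)].

(** Independence is stated for sets indexed by all of nat; from [K] on the default is the full
    set. *)
Let fiber (x : {ffun 'I_K -> F}) k : {set F} :=
  oapp (fun i => [set x i]%SET) finset.setT (insub k : option 'I_K).

Lemma hvec_fiber x : [set w | hvec w = x] =
  \bigcap_(k in [set` iota 0 K]) [set w | phi w (symfun_h k.+1) \in fiber x k].
Proof.
apply/seteqP; split=> [w /= <- k /=|w /= wx].
  by rewrite mem_iota add0n /= => kK; rewrite /fiber (insubT (fun k => k < K)%N kK) inE ffunE.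
apply/ffunP => k; rewrite ffunE; have := wx k.
by rewrite /= mem_iota add0n ltn_ord /fiber valK /= inE => /(_ isT) /eqP.
Qed.

Lemma fiberE x k (kK : (k < K)%N) :
  [set w | phi w (symfun_h k.+1) \in fiber x k] = [set w | phi w (symfun_h k.+1) = x (Ordinal kK)].
Proof.
by apply/seteqP; split=> w /=; rewrite /fiber (insubT (fun k => k < K)%N kK) inE => /eqP.
Qed.

Lemma measurable_hvec x : measurable [set w | hvec w = x].
Proof.
rewrite hvec_fiber; apply: fin_bigcap_measurable => // k /=.
by rewrite mem_iota add0n /= => kK; rewrite fiberE; exact: (urh_measurable phiP).
Qed.

Lemma prob_hvec x : P [set w | hvec w = x] = ((#|F|%:R^-1) ^+ K)%:E.
Proof.
rewrite hvec_fiber (urh_independent phiP) ?iota_uniq //.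
rewrite (eq_big_seq (fun=> (#|F|%:R^-1)%:E)) => [|k].
  by rewrite prodEFin big_const_seq count_predT size_iota iter_mulr_1.
by rewrite mem_iota add0n /= => kK; rewrite fiberE (urh_uniform phiP).
Qed.

(** The event is a finite disjoint union of the fibers of [hvec], which all have the same
    probability. *)
Lemma prob_hvec_in (E : {set {ffun 'I_K -> F}}) :
  P [set w | hvec w \in E] = (#|E|%:R / #|F|%:R ^+ K)%:E.
Proof.
have -> : [set w | hvec w \in E] = \bigcup_(x in [set` enum E]) [set w | hvec w = x].
  apply/seteqP; split=> [w /= wE|w [x /=]]; first by exists (hvec w); rewrite //= mem_enum.
  by rewrite mem_enum => xE ->.
rewrite measure_fin_bigcup //; last 2 first.
- by move=> x y _ _ [w [/= <- <-]].
- by move=> x _; exact: measurable_hvec.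
rewrite -fsbig_seq ?enum_uniq // (eq_bigr _ (fun x _ => prob_hvec x)).
by rewrite sumEFin big_enum sumr_const mulr_natl exprVn.
Qed.
End UniformHom.

Theorem theorem5p5 (R : realType) (l : intpart) (l_nonempty : parts l <> [::]) :
  exists (c : R) (n0 : nat), 0 < c /\ (0 < n0)%N /\
    forall (F : finFieldType) (d : measure_display) (T : measurableType d)
      (P : probability T R) (phi : T -> {rmorphism symfun -> F}),
      uniform_random_hom P phi -> (n0 < #|F|)%N ->
      `| fine (P [set w | phi w (symfun_s l) = 0]) - #|F|%:R^-1 |
        <= c * `| (#|F|%:R ^+ 2)^-1 |.
Proof.
have [m lm] : exists m, size l = m.+1.
  by case: (parts l) l_nonempty => // a s _; exists (size s).
pose C := (2 ^ (m + m).+2)%N.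
exists C%:R, 1%N; split; first by rewrite ltr0n expn_gt0.
split=> // F d T P phi phiP q_gt1; pose K := (head 0 l + size l)%N.
pose E := bad_row K (size l) F (row_start l) (size l) (size l).
have -> : [set w | phi w (symfun_s l) = 0] = [set w | hvec phi K w \in E].
  apply/seteqP; split=> w /=; rewrite (rmorph_symfun_s (phi w) (leqnn _)).
    by move=> /det_hmx_eq0.
  by move=> wE; apply/det_hmx_eq0.
rewrite (prob_hvec_in phiP) /=.
(* The last part of [l] is positive, which excludes a last row (0, ..., 0, 1). *)
have sm : (size l < row_start l m + m)%N.
  by rewrite /row_start lm; have := nth_partition_gt0 (l := l) (i := m); rewrite lm => /(_ (ltnSn m)); lia.
have := square_count F (hshape_row_start lm) sm.
rewrite -lm -/E -/C card_ffun card_ord -/K; clearbody C => -[].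
rewrite -!(ler_nat R) !natrD !natrM !natrX.
have : 0 < #|F|%:R :> R by rewrite ltr0n ltnW.
move: (#|F|%:R : R) (#|E|%:R : R) (C%:R : R) => {C}q e C q0 up lo.
have Q0 : 0 < q ^+ K by rewrite exprn_gt0.
move: (q ^+ K) Q0 up lo => Q Q0 up lo.
have q2 : 0 < q ^+ 2 by rewrite exprn_gt0.
have Qq : 0 < Q * q ^+ 2 by rewrite mulr_gt0.
(* Over the common denominator the bound becomes the pair of inequalities [up] and [lo]. *)
have -> : e / Q - q^-1 = (e * q ^+ 2 - Q * q) / (Q * q ^+ 2).
  by field; rewrite !lt0r_neq0.
rewrite normrM normfV (gtr0_norm Qq) ler_pdivrMr // normfV (gtr0_norm q2).
have -> : C / q ^+ 2 * (Q * q ^+ 2) = C * Q by field; rewrite lt0r_neq0.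
by rewrite ler_norml; lra.
Qed.
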